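(* Assume that the numerical fluxes satisfy the exact flux conditions: (i) for every interior face $\Gamma=\partial K\cap\partial L$ one has $F_{K,\Gamma}(\mathbf u,\mathbf y_h)=-F_{L,\Gamma}(\mathbf u,\mathbf y_h)$; (ii) $D_{\mathbf u}1=0$, where $1\in X_h$ is the vector with all entries equal to $1$; (iii) the face integrals $\int_\Gamma \mathbf u\cdot\mathbf n_K\,d\sigma$ used to build $F_{K,\Gamma}$ are evaluated exactly (or enforced so that (i)--(ii) hold exactly); here $\mathbf u\in U$ and $\mathbf y_h\in X_h$ are arbitrary. Let $\{(v_i^{(n)})_{i=1}^m\}_{n=0}^{N_t-1}\subset\mathbb R^m$ be given discrete velocity coefficients, let $\theta_h^{(0)},\rho_h^{(N_t)}\in X_h$ be arbitrary, and let $\{\theta_h^{(n)}\}_{n=0}^{N_t}$ and $\{\rho_h^{(n)}\}_{n=0}^{N_t}$ in $X_h$ be the solutions of $$\frac{\theta_h^{(n+1)}-\theta_h^{(n)}}{\Delta t}+\sum_{i=1}^m v_i^{(n)}D_{\mathbf b_i}\frac{\theta_h^{(n+1)}+\theta_h^{(n)}}{2}=0,\qquad n=0,\dots,N_t-1,$$ with initial value $\theta_h^{(0)}$, and $$\frac{\rho_h^{(n)}-\rho_h^{(n+1)}}{-\Delta t}+\sum_{i=1}^m v_i^{(n)}D_{\mathbf b_i}\frac{\rho_h^{(n)}+\rho_h^{(n+1)}}{2}=0,\qquad n=N_t-1,\dots,1,0,$$ with terminal value $\rho_h^{(N_t)}$. Then for each $n\in\{0,1,\dots,N_t\}$: 1.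 (Mass conservation) $M_h(\theta_h^{(n)})=M_h(\theta_h^{(0)})$ and $M_h(\rho_h^{(n)})=M_h(\rho_h^{(N_t)})$; 2. (Energy conservation) $E_h(\theta_h^{(n)})=E_h(\theta_h^{(0)})$ and $E_h(\rho_h^{(n)})=E_h(\rho_h^{(N_t)})$; 3. (State--adjoint consistency) $\langle\theta_h^{(n)},\rho_h^{(n)}\rangle_{X_h}=\langle\theta_h^{(N_t)},\rho_h^{(N_t)}\rangle_{X_h}$.
   Context: $\Omega\subset\mathbb R^d$ is a bounded domain with outward unit normal $\mathbf n_\Omega$. $U:=\mathrm{span}\{\mathbf b_1,\dots,\mathbf b_m\}$, where $\mathbf b_i\in C^1(\overline\Omega;\mathbb R^d)$ are orthonormal in $L^2(\Omega;\mathbb R^d)$ and satisfy $\mathrm{div}\,\mathbf b_i=0$ in $\Omega$ and $\mathbf b_i\cdot\mathbf n_\Omega=0$ on $\partial\Omega$. $T>0$, $N_t$ is a positive integer, $\Delta t=T/N_t$. $\mathcal T_h$ is an admissible mesh of size $h>0$ of $\Omega$: a finite family of open, convex polygonal (polyhedral) control volumes $K$ forming a conforming partition of $\Omega$, with constants $c_1,c_2>0$ such that $c_1h^d\le|K|$ and $|\partial K|\le c_2h^{d-1}$ for each $K\in\mathcal T_h$. $\mathbf n_K$ is the unit outward normal on $\partial K$. $\mathcal F_K$ is the set of faces of $K$. For $\Gamma\in\mathcal F_K$ with $\Gamma\not\subset\partial\Omega$ (interior face), $L(K,\Gamma)$ is the unique other control volume in $\mathcal T_h$ sharing the face $\Gamma$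 with $K$. $X_h:=\mathbb R^{|\mathcal T_h|}$ (vectors indexed by $K\in\mathcal T_h$) with inner product $\langle(a_K),(b_K)\rangle_{X_h}:=\sum_{K\in\mathcal T_h}a_Kb_K|K|$ and the induced norm $\|\cdot\|_{X_h}$. Numerical flux: for $\mathbf u\in U$ and $\mathbf y_h=(y_K)_{K\in\mathcal T_h}\in X_h$, $$F_{K,\Gamma}(\mathbf u,\mathbf y_h):=\frac{y_K+y_{L(K,\Gamma)}}{2}\int_\Gamma\mathbf u\cdot\mathbf n_K\,d\sigma .$$ Discrete divergence operator on $X_h$: $$D_{\mathbf u}(\mathbf y_h):=\Big(\frac1{|K|}\sum_{\Gamma\in\mathcal F_K,\ \Gamma\not\subset\partial\Omega}F_{K,\Gamma}(\mathbf u,\mathbf y_h)\Big)_{K\in\mathcal T_h}.$$ Discrete mass and energy: for $\xi_h=(\xi_{h,K})_{K\in\mathcal T_h}\in X_h$, $M_h(\xi_h):=\sum_{K\in\mathcal T_h}\xi_{h,K}|K|$ and $E_h(\xi_h):=\|\xi_h\|_{X_h}^2$. *)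

(* Defs.v *)
From HB Require Import structures.
From mathcomp Require Import all_boot all_order all_algebra finmap.
From mathcomp Require Import all_classical all_reals all_analysis.
Set Implicit Arguments.
Unset Strict Implicit.
Unset Printing Implicit Defensive.
Import Order.TTheory GRing.Theory Num.Theory.
Import numFieldNormedType.Exports.
Local Open Scope classical_set_scope.
Local Open Scope ring_scope.

(* Infimum of the total weights of the countable covers by the sets [S i],
   [i] in [D]; [None] stands for the empty set, of weight 0, so that finite
   covers are allowed. *)
Section covering_outer_measure.
Local Open Scope ereal_scope.
Context {R : realType} {T I : Type}.
Variables (D : set I) (S : I -> set T) (w : I -> R).

Definition cover_weight (i : nat -> option I) : \bar R :=
  \sum_(k <oo) (oapp w 0%R (i k))%:E.

Definition countable_cover (A : set T) : set (nat -> option I) :=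
  [set i | (forall k j, i k = Some j -> D j) /\
           A `<=` \bigcup_k oapp S set0 (i k)].

Definition cover_inf (A : set T) : \bar R :=
  ereal_inf [set cover_weight i | i in countable_cover A].

Hypothesis w0 : forall i, D i -> (0 <= w i)%R.

Lemma cover_term_ge0 A i : countable_cover A i ->
  forall k, 0 <= (oapp w 0%R (i k))%:E.
Proof.
by move=> [Di _] k; rewrite lee_fin; case E: (i k) => [j|]//=; exact/w0/(Di k).
Qed.

Lemma cover_inf_ge0 A : 0 <= cover_inf A.
Proof.
apply: le_ereal_inf_tmp => _ [i iA <-].
by apply: nneseries_ge0 => k _ _; exact: cover_term_ge0 iA k.
Qed.

Lemma cover_inf0 : cover_inf set0 = 0.
Proof.
apply/eqP; rewrite eq_le cover_inf_ge0 andbT; apply: ereal_inf_lbound.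
exists (fun=> None); first by split.
by rewrite /cover_weight/= eseries0.
Qed.

Lemma le_cover_inf : {homo cover_inf : A B / A `<=` B >-> A <= B}.
Proof.
move=> A B AB; apply: ereal_inf_le_tmp => _ [i [Di Bi] <-].
by exists i => //; split => //; exact: subset_trans Bi.
Qed.

Lemma cover_inf_sigma_subadditive : sigma_subadditive cover_inf.
Proof.
move=> A; have [[i ioo]|] := pselect (exists i, cover_inf (A i) = +oo).
  rewrite (eseries_pinfty _ _ ioo) ?leey// => n _.
  by rewrite -ltNye (lt_le_trans _ (cover_inf_ge0 _)).
rewrite -forallNE => Aoo.
suff add2e (e : {posnum R}) :
    cover_inf (\bigcup_n A n) <= \sum_(i <oo) cover_inf (A i) + e%:num%:E.
  by apply/lee_addgt0Pr => _/posnumP[].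
rewrite (le_trans _ (epsilon_trick _ _ _))//; last first.
  by move=> n; exact: cover_inf_ge0.
pose P n (i : nat -> option I) := countable_cover (A n) i /\
  cover_weight i <= cover_inf (A n) + (e%:num / (2 ^ n.+1)%:R)%:E.
have [G PG] : {G : nat -> nat -> option I & forall n, P n (G n)}.
  apply: (@choice _ _ P) => n; rewrite /P.
  have en1 : (0 < e%:num / (2 ^ n.+1)%:R)%R by [].
  have fA : cover_inf (A n) \is a fin_num.
    by rewrite ge0_fin_numE ?cover_inf_ge0// ltey; exact/eqP/Aoo.
  have [x [i Ai <-] xS] := lb_ereal_inf_adherent en1 fA.
  by exists i; split => //; exact: ltW.
pose h (p : nat * nat) : \bar R := (oapp w 0%R (G p.1 p.2))%:E.
have h0 p : 0 <= h p by exact: cover_term_ge0 (PG p.1).1 p.2.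
apply: (@le_trans _ _ (\esum_(p in setT) h p)).
  apply: ereal_inf_lbound => /=.
  have /card_esym/ppcard_eqP[f] := card_nat2.
  exists (fun k => G (f k).1 (f k).2).
    split => [k j|t [n _]]; first exact: (PG (f k).1).1.1.
    move=> /(PG n).1.2 [j _ Gt]; exists (f^-1%FUN (n, j)) => //=.
    by rewrite invK ?inE.
  rewrite (reindex_esum setT setT f)// /cover_weight nneseries_esumT// => k.
  exact: h0 (f k).
have -> : \esum_(p in setT) h p = \sum_(n <oo) cover_weight (G n).
  rewrite nneseries_esumT => [|n]; last first.
    by apply: nneseries_ge0 => k _ _; exact: cover_term_ge0 (PG n).1 k.
  transitivity (\esum_(n in setT) \esum_(k in setT) h (n, k)).
    rewrite esum_esum; last by move=> n k _ _; exact: h0.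
    by rewrite (_ : _ `*`` _ = setT); [by apply: eq_esum; case|exact/seteqP].
  apply: eq_esum => n _; rewrite /cover_weight nneseries_esumT// => k.
  exact: h0 (n, k).
apply: lee_nneseries => [n _ _|n _]; last exact: (PG n).2.
by apply: nneseries_ge0 => k _ _; exact: cover_term_ge0 (PG n).1 k.
Qed.

End covering_outer_measure.

Section euclidean_measures.
Context {R : realType} {n : nat}.
Local Notation V := 'rV[R]_n.

Definition dot (x y : V) : R := \sum_i x 0 i * y 0 i.

(* The norm of the library on ['rV_n] is the sup norm. *)
Definition enorm (x : V) : R := Num.sqrt (dot x x).

Definition diam (A : set V) : R := sup [set enorm (x - y) | x in A & y in A].

Definition boxes : set (V * V) := [set ab : V * V | forall i, ab.1 0 i <= ab.2 0 i].

Definition box (ab : V * V) : set V :=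
  [set x : V | forall i, ab.1 0 i <= x 0 i <= ab.2 0 i].

Definition box_volume (ab : V * V) : R := \prod_i (ab.2 0 i - ab.1 0 i).

Definition lebesgue_outer : set V -> \bar R := cover_inf boxes box box_volume.

Lemma box_volume_ge0 ab : boxes ab -> 0 <= box_volume ab.
Proof. by move=> ab0; apply: prodr_ge0 => i _; rewrite subr_ge0; exact: ab0. Qed.

HB.instance Definition _ := isOuterMeasure.Build R V lebesgue_outer
  (cover_inf0 box box_volume_ge0) (cover_inf_ge0 box box_volume_ge0)
  (le_cover_inf boxes box box_volume)
  (cover_inf_sigma_subadditive box box_volume_ge0).

Definition small_sets (e : R) : set (set V) :=
  [set A | forall x y, A x -> A y -> enorm (x - y) <= e].

(* Volume of the unit ball of [R^s]. *)
Fixpoint unit_ball_volume (s : nat) : R :=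
  match s with
  | 0 => 1
  | 1 => 2
  | s'.+2 => 2 * pi / s%:R * unit_ball_volume s'
  end.

Definition hausdorff_weight (s : nat) (A : set V) : R :=
  unit_ball_volume s * (diam A / 2) ^+ s.

(* [s]-dimensional Hausdorff measure, with the normalisation for which it is
   the Lebesgue measure if [s = n] and the surface measure if [s = n.-1].  Like
   [lebesgue_outer] it is a metric outer measure, so that all Borel sets are
   Caratheodory measurable for it. *)
Definition hausdorff_outer (s : nat) (A : set V) : \bar R :=
  ereal_sup [set cover_inf (small_sets e) id (hausdorff_weight s) A
            | e in [set e | 0 < e]].

Lemma unit_ball_volume_ge0 s : 0 <= unit_ball_volume s.
Proof.
suff: 0 <= unit_ball_volume s /\ 0 <= unit_ball_volume s.+1 by case.
elim: s => [|s [s0 s1]]; first by split => /=.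
split => //; rewrite [X in 0 <= X]/=.
by rewrite mulr_ge0// divr_ge0// mulr_ge0// pi_ge0.
Qed.

Lemma diam_ge0 A : 0 <= diam A.
Proof.
have [hs|hs] := pselect (has_sup [set enorm (x - y) | x in A & y in A]).
  have [[r Ar] ubA] := hs; apply: le_trans (ub_le_sup ubA Ar).
  by case: Ar => x _ [y _ <-]; exact: sqrtr_ge0.
by rewrite /diam sup_out.
Qed.

Lemma hausdorff_weight_ge0 s (D : set (set V)) A :
  D A -> 0 <= hausdorff_weight s A.
Proof.
by move=> _; rewrite mulr_ge0 ?unit_ball_volume_ge0// exprn_ge0// divr_ge0// diam_ge0.
Qed.

Let H s e := cover_inf (small_sets e) id (hausdorff_weight s).

Let leH s e A : 0 < e -> (H s e A <= hausdorff_outer s A)%E.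
Proof. by move=> e0; apply: ereal_sup_ubound; exists e. Qed.

Lemma hausdorff_outer_ge0 s A : (0 <= hausdorff_outer s A)%E.
Proof.
apply: le_trans (leH s A ltr01).
exact: (cover_inf_ge0 id (@hausdorff_weight_ge0 s _)).
Qed.

Lemma hausdorff_outer0 s : hausdorff_outer s set0 = 0%E.
Proof.
apply/eqP; rewrite eq_le hausdorff_outer_ge0 andbT.
apply: ge_ereal_sup => _ [e e0 <-].
by rewrite (cover_inf0 id (@hausdorff_weight_ge0 s _)).
Qed.

Lemma le_hausdorff_outer s :
  {homo hausdorff_outer s : A B / A `<=` B >-> (A <= B)%E}.
Proof.
move=> A B AB; apply: ge_ereal_sup => _ [e e0 <-].
exact: le_trans (le_cover_inf _ _ _ AB) (leH s B e0).
Qed.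

Lemma hausdorff_outer_sigma_subadditive s :
  sigma_subadditive (hausdorff_outer s).
Proof.
move=> A; apply: ge_ereal_sup => _ [e e0 <-].
have He := @hausdorff_weight_ge0 s (small_sets e).
apply: le_trans (cover_inf_sigma_subadditive id He _) _.
apply: lee_nneseries => [k _ _|k _]; first exact: cover_inf_ge0 He _.
exact: leH.
Qed.

HB.instance Definition _ s := isOuterMeasure.Build R V (hausdorff_outer s)
  (hausdorff_outer0 s) (hausdorff_outer_ge0 s) (@le_hausdorff_outer s)
  (@hausdorff_outer_sigma_subadditive s).

Definition lebesgue_outer_measure : {outer_measure set V -> \bar R} :=
  lebesgue_outer.

Definition surface_outer_measure : {outer_measure set V -> \bar R} :=
  hausdorff_outer n.-1.

Definition lebesgue_rV :
    {measure set (caratheodory_type lebesgue_outer_measure) -> \bar R} :=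
  (lebesgue_outer_measure :
    set (caratheodory_type lebesgue_outer_measure) -> \bar R).

Definition surface_measure :
    {measure set (caratheodory_type surface_outer_measure) -> \bar R} :=
  (surface_outer_measure :
    set (caratheodory_type surface_outer_measure) -> \bar R).

End euclidean_measures.

Section domains_and_fields.
Context {R : realType} {d : nat}.
Local Notation V := 'rV[R]_d.
Implicit Types (A Omega : set V) (f : V -> V).

Definition boundary A : set V := closure A `\` interior A.

(* At a boundary point [x] of [A], the blow-up of [A] around [x] is the open
   half-space of outward unit normal [nu]. *)
Definition is_outward_normal A (x nu : V) : Prop :=
  [/\ boundary A x, enorm nu = 1 &
   forall e : R, 0 < e -> \forall y \near x,
     (dot nu (y - x) < - (e * enorm (y - x)) -> A y) /\
     (e * enorm (y - x) < dot nu (y - x) -> ~ A y)].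

(* The outward unit normal, with the value 0 where there is none, e.g. at the
   vertices of a polyhedron. *)
Definition outward_normal A (x : V) : V := xget 0 [set nu | is_outward_normal A x nu].

Record domain_with_normal Omega : Prop := {
  domain_open : open Omega;
  domain_connected : connected Omega;
  domain_nonempty : Omega !=set0;
  domain_bounded : bounded_set Omega;
  domain_normal_ae : surface_measure
    [set x | boundary Omega x /\ ~ exists nu, is_outward_normal Omega x nu] = 0%E
}.

Definition partial_derivative (j : 'I_d) f (x : V) : V := 'D_(delta_mx 0 j) f x.

Definition divergence f (x : V) : R := \sum_j partial_derivative j f x 0 j.

Definition C1_closure Omega f : Prop :=
  [/\ {within closure Omega, continuous f},
      forall x, Omega x -> differentiable f x &
      forall j, exists2 g : V -> V, {within closure Omega, continuous g} &
        forall x, Omega x -> g x = partial_derivative j f x].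

(* A field on [closure Omega] is given by any extension of it to [R^d]. *)
Record velocity_basis Omega (m : nat) (b : 'I_m -> V -> V) : Prop := {
  basis_C1 : forall i, C1_closure Omega (b i);
  basis_orthonormal : forall i j,
    (\int[lebesgue_rV]_(x in Omega) dot (b i x) (b j x))%R = (i == j)%:R;
  basis_div : forall i x, Omega x -> divergence (b i) x = 0;
  basis_tangent : forall i x, boundary Omega x ->
    dot (b i x) (outward_normal Omega x) = 0
}.

Definition velocity_space (m : nat) (b : 'I_m -> V -> V) : set (V -> V) :=
  [set u | exists c : 'I_m -> R, u = fun x => \sum_i c i *: b i x].

End domains_and_fields.

Section meshes.
Context {R : realType} {d : nat}.
Local Notation V := 'rV[R]_d.
Implicit Types (Omega K G : set V) (Th : {fset set V}).

Definition polyhedral_cell K : Prop :=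
  K !=set0 /\ exists s : seq (V * R),
    K = [set x | forall p, p \in s -> dot p.1 x < p.2].

(* Exposed face; [K] itself and the empty set are faces of [K]. *)
Definition is_face K G : Prop :=
  exists (a : V) (c : R), (forall x, closure K x -> dot a x <= c) /\
    G = closure K `&` [set x | dot a x = c].

(* Face of dimension [d.-1]: its interior relative to a supporting hyperplane
   is nonempty. *)
Definition is_facet K G : Prop :=
  exists (a : V) (c : R), [/\ a != 0,
    forall x, closure K x -> dot a x <= c,
    G = closure K `&` [set x | dot a x = c] &
    exists2 x, G x & \forall y \near x, dot a y = c -> G y].

(* [fset_set] of an infinite set is empty, but a polyhedron has finitely many
   facets. *)
Definition faces K : {fset set V} := fset_set [set G | is_facet K G].

Definition mesh_size Th : R := sup [set diam (val K) | K in [set: Th]].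

Record admissible_mesh Omega (h : R) Th : Prop := {
  mesh_cells : forall K : Th, polyhedral_cell (val K);
  mesh_inside : forall K : Th, val K `<=` Omega;
  mesh_disjoint : forall K L : Th, K != L -> val K `&` val L = set0;
  mesh_cover : closure Omega = \bigcup_(K in [set: Th]) closure (val K);
  mesh_conforming : forall K L : Th, K != L ->
    is_face (val K) (closure (val K) `&` closure (val L)) /\
    is_face (val L) (closure (val K) `&` closure (val L));
  mesh_neighbor : forall (K : Th) G, G \in faces (val K) ->
    ~ G `<=` boundary Omega ->
    exists! L : Th, L != K /\ G \in faces (val L);
  mesh_sizeE : h = mesh_size Th;
  mesh_regular : exists c1 c2 : R, [/\ 0 < c1, 0 < c2 & forall K : Th,
    ((c1 * h ^+ d)%:E <= lebesgue_rV (val K))%E /\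
    (surface_measure (boundary (val K)) <= (c2 * h ^+ d.-1)%:E)%E]
}.

End meshes.

Section discrete_operators.
Context {R : realType} {d : nat}.
Local Notation V := 'rV[R]_d.
Variables (Omega : set V) (Th : {fset set V}).

Definition Xh : lmodType R := {ffun Th -> R^o}.

Definition vol (K : Th) : R := fine (lebesgue_rV (val K)).

Definition inner (a b : Xh) : R := \sum_(K : Th) a K * b K * vol K.

Definition normX (a : Xh) : R := Num.sqrt (inner a a).

Definition mass (xi : Xh) : R := \sum_(K : Th) xi K * vol K.

Definition energy (xi : Xh) : R := normX xi ^+ 2.

Definition interior_face (K : Th) (G : set V) : Prop :=
  G \in faces (val K) /\ ~ G `<=` boundary Omega.

(* The other control volume having [G] as a face; [K] if there is none. *)
Definition neighbor (K : Th) (G : set V) : Th :=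
  odflt K [pick L : Th | (L != K) && (G \in faces (val L))].

Definition face_integral (u : V -> V) (K : Th) (G : set V) : R :=
  (\int[surface_measure]_(x in G) dot (u x) (outward_normal (val K) x))%R.

(* [phi u K G] is the value used in the scheme for [face_integral u K G]. *)
Variable phi : (V -> V) -> Th -> set V -> R.

Definition flux (K : Th) (G : set V) (u : V -> V) (y : Xh) : R :=
  (y K + y (neighbor K G)) / 2 * phi u K G.

Definition discrete_div (u : V -> V) (y : Xh) : Xh :=
  [ffun K => (vol K)^-1 *
    \sum_(G <- faces (val K) | ~~ `[< G `<=` boundary Omega >]) flux K G u y].

Definition flux_antisymmetric (U : set (V -> V)) : Prop :=
  forall (K L : Th) (G : set V), K != L ->
    interior_face K G -> interior_face L G ->
    forall u (y : Xh), U u -> flux K G u y = - flux L G u y.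

Definition flux_divergence_free (U : set (V -> V)) : Prop :=
  forall u, U u -> discrete_div u [ffun=> 1] = 0.

Definition face_integrals_exact (U : set (V -> V)) : Prop :=
  forall u (K : Th) (G : set V), U u -> interior_face K G ->
    phi u K G = face_integral u K G.

(* The second alternative of the last condition allows face integrals that are
   not exact but are enforced so that the first two conditions hold. *)
Definition exact_flux_conditions (U : set (V -> V)) : Prop :=
  [/\ flux_antisymmetric U, flux_divergence_free U &
      face_integrals_exact U \/
      (flux_antisymmetric U /\ flux_divergence_free U)].

End discrete_operators.

(* Main.v *)
Require Import Defs.
From mathcomp Require Import all_boot all_order all_algebra finmap.
From mathcomp Require Import all_classical all_reals all_analysis.
From mathcomp Require Import ring.
Import Order.TTheory GRing.Theory Num.Theory.
Import numFieldNormedType.Exports.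
Local Open Scope classical_set_scope.
Local Open Scope ring_scope.

(** The exact flux conditions make every operator [discrete_div Omega phi u],
    [u] in [U], skew-adjoint for [inner].  By [flux_divergence_free] the
    outgoing fluxes through the interior faces of a cell sum to zero
    ([sum_face_values_eq0]), so the half of the centred flux that involves the
    value in the cell itself cancels.  What remains pairs the value in a cell
    with the values in its neighbours ([inner_discrete_div]).  Exchanging the
    two cells of each face ([sum_faces_neighbor]) only reverses the sign of the
    flux, and the bilinear form is therefore antisymmetric
    ([discrete_div_skew_adjoint]).

    The factor [(vol K)^-1] of [discrete_div] cancels the weight of [inner] only
    if [vol K], the real part of an extended real measure, is not zero.  This is
    [vol_gt0]: mesh regularity gives a positive lower bound, and the cells lie in
    the bounded set [Omega], so their measure is finite.

    A midpoint step [a' - a = k *: A (2^-1 *: (a' + a))] by a skew-adjoint [A]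
    preserves the inner product of any two of its solutions
    ([midpoint_inner_eq]).  The theorem consists of instances of this fact for
    a single recursion.  The adjoint scheme, run backwards from its terminal
    value, satisfies the same relation between consecutive steps as the forward
    scheme, which gives the state-adjoint consistency; the energy is the inner
    product of a solution with itself; the constant 1 is a solution because its
    discrete divergence vanishes, and the mass is the inner product with it. *)

(** * Bounded sets have finite Lebesgue measure *)

Lemma cover_inf_le {R : realType} {T I : Type} (D : set I) (S : I -> set T)
    (w : I -> R) (A : set T) (i : I) :
  D i -> 0 <= w i -> A `<=` S i -> (cover_inf D S w A <= (w i)%:E)%E.
Proof.
move=> Di w0 ASi; apply: ereal_inf_lbound.
exists (fun k => if k is 0%N then Some i else None).
  split=> [[|k] j //= [<-]//|x Ax].
  by exists 0%N => //=; exact: ASi.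
rewrite /cover_weight nneseries_recl//= => [|[|k] _]; rewrite ?lee_fin//.
rewrite (_ : limn _ = 0%E) ?adde0//.
by apply: eseries0 => -[|k].
Qed.

(** The norm of ['rV_d] is the sup norm, so a bounded set lies in one box. *)
Lemma lebesgue_rV_bounded_fin_num {R : realType} {d : nat} {A : set 'rV[R]_d} :
  bounded_set A -> lebesgue_rV A \is a fin_num.
Proof.
move=> [r [_ /(_ (r + 1))]]; rewrite ltrDl ltr01 => /(_ isT) AM.
rewrite ge0_fin_numE//; set M := r + 1 in AM.
(* The corners must be ordered, and [M] may be negative if [A] is empty. *)
pose M' := Num.max M 0.
pose c : 'rV[R]_d * 'rV[R]_d := (const_mx (- M'), const_mx M').
have cB : boxes c.
  by move=> i; rewrite !mxE (le_trans (y := 0)) ?oppr_le0 ?le_max ?lexx ?orbT.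
apply: le_lt_trans (ltry (box_volume c)).
apply: cover_inf_le => //; first exact: box_volume_ge0.
move=> x Ax i; rewrite !mxE -ler_norml le_max; apply/orP; left.
apply: le_trans (AM x Ax).
rewrite [leRHS]/Num.norm/= mx_normrE.
exact: (le_bigmax _ (fun ij => `|x ij.1 ij.2|) (0, i)).
Qed.

(** * Cell volumes and neighbours *)

Section mesh_geometry.
Context {R : realType} {d : nat} {Omega : set 'rV[R]_d} {h : R}
  {Th : {fset set 'rV[R]_d}}.
Hypotheses (Omega_bounded : bounded_set Omega) (h_gt0 : 0 < h)
  (Th_mesh : admissible_mesh Omega h Th).

(** Finiteness matters as much as the lower bound: [fine] sends an infinite
    measure to 0. *)
Lemma vol_gt0 (K : Th) : 0 < vol K.
Proof.
have [c1 [c2 [c1_gt0 _ /(_ K) [volK _]]]] := mesh_regular Th_mesh.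
have K_bounded : bounded_set (val K).
  apply: sub_boundedr Omega_bounded => A AOmega x Kx; apply: AOmega.
  exact: (mesh_inside Th_mesh) Kx.
have Kfin := lebesgue_rV_bounded_fin_num K_bounded.
rewrite -lte_fin /vol fineK//; apply: lt_le_trans volK.
by rewrite lte_fin mulr_gt0// exprn_gt0.
Qed.

Lemma neighborP {K : Th} {G : set 'rV[R]_d} : interior_face Omega K G ->
  neighbor K G != K /\ G \in faces (val (neighbor K G)).
Proof.
move=> [GK GOmega]; rewrite /neighbor; case: pickP => [L /andP[]//|noL].
have [L [[LK GL] _]] := mesh_neighbor Th_mesh GK GOmega.
by have := noL L; rewrite LK GL.
Qed.

(** [K] is a cell other than its neighbour across [G] that has the face [G], and
    the neighbour has only one such cell. *)
Lemma neighborK {K : Th} {G : set 'rV[R]_d} : interior_face Omega K G ->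
  neighbor (neighbor K G) G = K.
Proof.
move=> GK; have [LK GL] := neighborP GK.
have LG : interior_face Omega (neighbor K G) G by split=> //; exact: GK.2.
have [ML GM] := neighborP LG.
have [M [_ M_uniq]] := mesh_neighbor Th_mesh LG.1 LG.2.
rewrite -(M_uniq (neighbor (neighbor K G) G))//; apply: M_uniq; split=> //.
  by rewrite eq_sym.
exact: GK.1.
Qed.

(** Both sides run over the pairs of a cell and one of its interior faces; for a
    fixed face, [neighbor] is an involution of the cells that have it. *)
Lemma sum_faces_neighbor (f : Th -> set 'rV[R]_d -> R) :
  \sum_(K : Th) \sum_(G <- faces (val K) | ~~ `[< G `<=` boundary Omega >]) f K G =
  \sum_(K : Th) \sum_(G <- faces (val K) | ~~ `[< G `<=` boundary Omega >])
    f (neighbor K G) G.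
Proof.
(* A set of faces common to all cells, for the two sums to be exchanged. *)
pose F := \big[fsetU/fset0]_(K : Th) faces (val K).
have sum_by_face (g : Th -> set 'rV[R]_d -> R) :
  \sum_(K : Th) \sum_(G <- faces (val K) | ~~ `[< G `<=` boundary Omega >]) g K G =
  \sum_(G <- F | ~~ `[< G `<=` boundary Omega >])
    \sum_(K : Th | G \in faces (val K)) g K G.
  transitivity (\sum_(K : Th)
      \sum_(G <- F | (G \in faces (val K)) && ~~ `[< G `<=` boundary Omega >]) g K G).
    apply: eq_bigr => K _; rewrite -[RHS]big_filter_cond.
    apply: perm_big; apply: uniq_perm; rewrite ?filter_uniq//.
    move=> G; rewrite mem_filter; apply/idP/andP => [GK|[]//].
    by split=> //; apply/bigfcupP; exists K; rewrite ?mem_index_enum.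
  rewrite (exchange_big_dep (fun G => ~~ `[< G `<=` boundary Omega >]))/=; last first.
    by move=> K G _ /andP[].
  by apply: eq_bigr => G GOmega; apply: eq_bigl => K; rewrite GOmega andbT.
rewrite !sum_by_face; apply: eq_bigr => G /asboolP GOmega.
pose nb (K : Th) := neighbor K G.
rewrite (reindex_onto nb nb) /nb/=; last first.
  by move=> K GK; exact: neighborK.
apply: eq_bigl => K; apply/andP/idP => [[GL /eqP GK]|GK].
  have LG : interior_face Omega (neighbor K G) G by [].
  by rewrite -GK; have [] := neighborP LG.
have KG : interior_face Omega K G by [].
by rewrite neighborK//; have [_ ->] := neighborP KG.
Qed.

End mesh_geometry.

(** * Midpoint steps of skew-adjoint operators *)

Section inner_product.
Context {R : realType} {d : nat} {Th : {fset set 'rV[R]_d}}.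
Implicit Types a b c : Xh Th.

Lemma innerC a b : inner a b = inner b a.
Proof. by apply: eq_bigr => K _; rewrite (mulrC (a K)). Qed.

Lemma innerDl a b c : inner (a + b) c = inner a c + inner b c.
Proof. by rewrite -big_split; apply: eq_bigr => K _; rewrite ffunE !mulrDl. Qed.

Lemma innerZl (r : R) a b : inner (r *: a) b = r * inner a b.
Proof. by rewrite mulr_sumr; apply: eq_bigr => K _; rewrite ffunE !mulrA. Qed.

Lemma innerDr a b c : inner c (a + b) = inner c a + inner c b.
Proof. by rewrite innerC innerDl !(innerC c). Qed.

Lemma innerZr (r : R) a b : inner a (r *: b) = r * inner a b.
Proof. by rewrite innerC innerZl innerC. Qed.

Lemma mass_inner a : mass a = inner a [ffun=> 1].
Proof. by apply: eq_bigr => K _; rewrite ffunE mulr1. Qed.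

Lemma energy_inner a : (forall K : Th, 0 <= vol K) -> energy a = inner a a.
Proof.
move=> vol_ge0; rewrite /energy /normX sqr_sqrtr//.
by apply: sumr_ge0 => K _; rewrite mulr_ge0// -expr2 sqr_ge0.
Qed.

Lemma inner_suml (I : finType) (F : I -> Xh Th) b :
  inner (\sum_i F i) b = \sum_i inner (F i) b.
Proof.
apply: (big_morph (fun a => inner a b)) => [a c|]; first exact: innerDl.
by rewrite -(scale0r b) innerZl mul0r.
Qed.

Definition skew_adjoint (A : Xh Th -> Xh Th) : Prop :=
  forall a b, inner (A a) b = - inner a (A b).

Lemma skew_adjoint_lincomb {I : finType} (v : I -> R) {A : I -> Xh Th -> Xh Th} :
  (forall i, skew_adjoint (A i)) -> skew_adjoint (fun a => \sum_i v i *: A i a).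
Proof.
move=> A_skew a b; rewrite (innerC a) !inner_suml -sumrN; apply: eq_bigr => i _.
by rewrite !innerZl A_skew mulrN (innerC a).
Qed.

(** The difference of two products is [(a' - a, m_b) + (m_a, b' - b)] with the
    midpoints [m_a] and [m_b]; substituting the steps leaves
    [k * ((A m_a, m_b) + (m_a, A m_b)) = 0]. *)
Lemma midpoint_inner_eq {A : Xh Th -> Xh Th} {k : R} {a a' b b' : Xh Th} :
  skew_adjoint A ->
  a' - a = k *: A (2^-1 *: (a' + a)) -> b' - b = k *: A (2^-1 *: (b' + b)) ->
  inner a' b' = inner a b.
Proof.
move=> A_skew a_step b_step; apply/eqP; rewrite -subr_eq0; apply/eqP.
transitivity (inner (a' - a) (2^-1 *: (b' + b)) + inner (2^-1 *: (a' + a)) (b' - b)).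
  rewrite -(scaleN1r a) -(scaleN1r b) !(innerDl, innerDr, innerZl, innerZr).
  by field.
by rewrite a_step b_step innerZl innerZr A_skew mulrN addNr.
Qed.

End inner_product.

(** * Skew-adjointness of the discrete divergence *)

Section discrete_divergence.
Context {R : realType} {d : nat} {Omega : set 'rV[R]_d} {h : R}
  {Th : {fset set 'rV[R]_d}}.
Hypotheses (Omega_bounded : bounded_set Omega) (h_gt0 : 0 < h)
  (Th_mesh : admissible_mesh Omega h Th).
Context {phi : ('rV[R]_d -> 'rV[R]_d) -> Th -> set 'rV[R]_d -> R}
  {U : set ('rV[R]_d -> 'rV[R]_d)}.
Hypothesis phi_flux : exact_flux_conditions Omega phi U.

(** The flux of the constant 1 is the face value itself. *)
Lemma face_value_antisymmetric {u} {K : Th} {G : set 'rV[R]_d} :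
  U u -> interior_face Omega K G -> phi u (neighbor K G) G = - phi u K G.
Proof.
move=> Uu KG; have [LK GL] := neighborP Th_mesh KG.
have [anti _ _] := phi_flux.
have LG : interior_face Omega (neighbor K G) G by split=> //; exact: KG.2.
have := anti _ _ _ LK LG KG u [ffun=> 1] Uu.
by rewrite /flux !ffunE -mulr2n divff ?mul1r// pnatr_eq0.
Qed.

Lemma sum_face_values_eq0 {u} (K : Th) : U u ->
  \sum_(G <- faces (val K) | ~~ `[< G `<=` boundary Omega >]) phi u K G = 0.
Proof.
move=> Uu; have [_ /(_ u Uu) /ffunP /(_ K) + _] := phi_flux.
rewrite !ffunE => /eqP; rewrite mulf_eq0 invr_eq0.
rewrite gt_eqF ?(vol_gt0 Omega_bounded h_gt0 Th_mesh)//= => /eqP sum0.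
rewrite -[RHS]sum0; apply: eq_bigr => G _.
by rewrite /flux !ffunE -mulr2n divff ?mul1r// pnatr_eq0.
Qed.

(** The diagonal part of the form is [y K * z K / 2] times the total outgoing
    flux of [K], which vanishes. *)
Lemma inner_discrete_div {u} (y z : Xh Th) : U u ->
  inner (discrete_div Omega phi u y) z =
  \sum_(K : Th) \sum_(G <- faces (val K) | ~~ `[< G `<=` boundary Omega >])
    2^-1 * phi u K G * y (neighbor K G) * z K.
Proof.
move=> Uu; rewrite /inner; apply: eq_bigr => K _; rewrite ffunE.
have volK : vol K != 0 by rewrite gt_eqF// (vol_gt0 Omega_bounded h_gt0 Th_mesh).
rewrite mulrAC (mulrAC _ _ (vol K)) mulVf// mul1r mulr_suml.
transitivity (2^-1 * y K * z K *
    (\sum_(G <- faces (val K) | ~~ `[< G `<=` boundary Omega >]) phi u K G) +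
  \sum_(G <- faces (val K) | ~~ `[< G `<=` boundary Omega >])
    2^-1 * phi u K G * y (neighbor K G) * z K).
  by rewrite mulr_sumr -big_split; apply: eq_bigr => G _; rewrite /flux/=; ring.
by rewrite sum_face_values_eq0// mulr0 add0r.
Qed.

(** Exchanging the cells of each face turns [y (neighbor K G) * z K] into
    [y K * z (neighbor K G)] and changes the sign of the face value. *)
Lemma discrete_div_skew_adjoint {u} : U u -> skew_adjoint (discrete_div Omega phi u).
Proof.
move=> Uu y z; rewrite (innerC y) !inner_discrete_div//.
rewrite (sum_faces_neighbor Th_mesh) -sumrN; apply: eq_bigr => K _.
rewrite -sumrN big_seq_cond [RHS]big_seq_cond; apply: eq_bigr => G.
move=> /andP[GK /asboolP GOmega].
have KG : interior_face Omega K G by [].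
by rewrite (neighborK Th_mesh)// face_value_antisymmetric//; ring.
Qed.

End discrete_divergence.

(** * Conservation laws of the scheme *)

Theorem theorem3p1 (R : realType) (d : nat) (d_gt0 : (0 < d)%N)
  (Omega : set 'rV[R]_d) (Omega_domain : domain_with_normal Omega)
  (m : nat) (b : 'I_m -> 'rV[R]_d -> 'rV[R]_d)
  (b_basis : velocity_basis Omega b)
  (T : R) (T_gt0 : 0 < T) (Nt : nat) (Nt_gt0 : (0 < Nt)%N)
  (dt : R) (dtE : dt = T / Nt%:R)
  (h : R) (h_gt0 : 0 < h) (Th : {fset (set 'rV[R]_d)})
  (Th_mesh : admissible_mesh Omega h Th)
  (phi : ('rV[R]_d -> 'rV[R]_d) -> Th -> set 'rV[R]_d -> R)
  (phi_flux : exact_flux_conditions Omega phi (velocity_space b))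
  (v : nat -> 'I_m -> R)
  (theta rho : nat -> Xh Th)
  (theta_step : forall n, (n < Nt)%N ->
     dt^-1 *: (theta n.+1 - theta n) +
     \sum_(i < m) v n i *:
       discrete_div Omega phi (b i) (2^-1 *: (theta n.+1 + theta n)) = 0)
  (rho_step : forall n, (n < Nt)%N ->
     (- dt)^-1 *: (rho n - rho n.+1) +
     \sum_(i < m) v n i *:
       discrete_div Omega phi (b i) (2^-1 *: (rho n + rho n.+1)) = 0) :
  forall n, (n <= Nt)%N ->
    [/\ mass (theta n) = mass (theta 0%N) /\ mass (rho n) = mass (rho Nt),
        energy (theta n) = energy (theta 0%N) /\ energy (rho n) = energy (rho Nt) &
        inner (theta n) (rho n) = inner (theta Nt) (rho Nt)].
Proof.
have Omega_bounded := domain_bounded Omega_domain.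
have vol_ge0 (K : Th) : 0 <= vol K := ltW (vol_gt0 Omega_bounded h_gt0 Th_mesh K).
have dt_neq0 : dt != 0 by rewrite dtE gt_eqF// divr_gt0// ltr0n.
have b_velocity i : velocity_space b (b i).
  exists (fun j => (j == i)%:R); apply/funext => x.
  rewrite (bigD1 i)//= eqxx scale1r big1 ?addr0// => j /negPf->.
  by rewrite scale0r.
pose A n (a : Xh Th) : Xh Th := \sum_(i < m) v n i *: discrete_div Omega phi (b i) a.
have A_skew n : skew_adjoint (A n).
  apply: (skew_adjoint_lincomb (v n) (A := fun i => discrete_div Omega phi (b i))) => i.
  exact: (discrete_div_skew_adjoint Omega_bounded h_gt0 Th_mesh phi_flux (b_velocity i)).
(* The relation that [theta], [rho] and the constant 1 satisfy alike. *)
pose solves (a : nat -> Xh Th) :=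
  forall n, (n < Nt)%N -> a n.+1 - a n = - dt *: A n (2^-1 *: (a n.+1 + a n)).
have theta_solves : solves theta.
  move=> n /theta_step /eqP; rewrite addr_eq0 => /eqP E.
  by rewrite scaleNr -scalerN -E scalerA divff// scale1r.
have rho_solves : solves rho.
  move=> n /rho_step /eqP; rewrite addr_eq0 => /eqP E.
  rewrite scaleNr -scalerN (addrC (rho n.+1) (rho n)) -E scalerA invrN mulrN divff//.
  by rewrite scaleN1r opprB.
have one_solves : solves (fun=> [ffun=> 1]).
  move=> n _; rewrite subrr /A big1 ?scaler0// => i _.
  have -> : 2^-1 *: ([ffun=> 1] + [ffun=> 1]) = [ffun=> 1] :> Xh Th.
    apply/ffunP => K; rewrite !ffunE -mulr2n.
    by rewrite [LHS]mulVf// pnatr_eq0.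
  by have [_ -> //] := phi_flux; rewrite scaler0.
have conserved a c : solves a -> solves c ->
    forall n, (n <= Nt)%N -> inner (a n) (c n) = inner (a 0%N) (c 0%N).
  move=> a_solves c_solves; elim=> // n IH nNt; rewrite -IH ?(ltnW nNt)//.
  exact: midpoint_inner_eq (A_skew n) (a_solves n nNt) (c_solves n nNt).
have conserved_end a c : solves a -> solves c ->
    forall n, (n <= Nt)%N -> inner (a n) (c n) = inner (a Nt) (c Nt).
  by move=> a_solves c_solves n nNt; rewrite !(conserved a c).
move=> n nNt; split; first by split; rewrite !mass_inner;
  [exact: (conserved _ _ theta_solves one_solves)
  |exact: (conserved_end _ _ rho_solves one_solves)].
- by split; rewrite !energy_inner//; [exact: conserved|exact: conserved_end].
- exact: conserved_end.
Qed.
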